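(* Let $X$ and $Y$ be two compactly generated (Hausdorff) topological spaces. Let $f$ be a morphism of globular complexes from $\mathrm{Glob}(X)$ to $\mathrm{Glob}(Y)$. Then there exists a continuous map $f^S:X\to Y$, unique up to homotopy, such that $f$ is S-homotopic to $\mathrm{Glob}(f^S)$.
   Context: For a topological space $X$, $\mathrm{Glob}(X)$ is the quotient of $X\times[0,1]$ by $(x,0)=(x',0)$ and $(x,1)=(x',1)$ for all $x,x'\in X$; the class of $(x,0)$ is $\underline\iota$ and that of $(x,1)$ is $\underline\sigma$. It is partially ordered by the image of $\{((x,t),(x,t')) : t\le t'\}$. For continuous $g:X\to Y$, $\mathrm{Glob}(g)(x,t)=(g(x),t)$. A non-constant execution path of $\mathrm{Glob}(X)$ is a continuous non-decreasing map $\gamma:[0,1]\to\mathrm{Glob}(X)$ with $\gamma(0)=\underline\iota$ and $\gamma(1)=\underline\sigma$. A morphism of globular complexes $f:\mathrm{Glob}(X)\to\mathrm{Glob}(Y)$ is a continuous map with $f(\{\underline\iota,\underline\sigma\})\subset\{\underline\iota,\underline\sigma\}$ such that $f\circ\gamma$ is a non-constant execution path of $\mathrm{Glob}(Y)$ for every non-constant execution path $\gamma$ of $\mathrm{Glob}(X)$. Two such morphisms $f,g$ are S-homotopic if there is a continuous map $H:\mathrm{Glob}(X)\times[0,1]\to\mathrm{Glob}(Y)$ with $H(-,0)=f$, $H(-,1)=g$ and each $H(-,u)$ a morphism of globular complexes. A Hausdorff space is compactly generated when its topology is the weak topology determined by its compact subspaces. *)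

(* Defs.v *)
From HB Require Import structures.
From mathcomp Require Import all_boot all_order all_algebra generic_quotient.
From mathcomp Require Import all_classical all_reals all_analysis.
Set Implicit Arguments.
Unset Strict Implicit.
Unset Printing Implicit Defensive.
Import Order.TTheory GRing.Theory Num.Theory.
Import numFieldNormedType.Exports.
Local Open Scope classical_set_scope.
Local Open Scope ring_scope.
Local Open Scope quotient_scope.

Definition compactly_generated (X : topologicalType) : Prop :=
  hausdorff_space X /\
  forall A : set X, open A <->
    forall K : set X, compact K -> open (set_val @^-1` A : set (set_type K)).

Definition unit_itv (R : realType) : set R := `[0, 1]%classic.

Arguments unit_itv R : clear implicits.

(* [0, 1] as a space: [set_type] carries the topology induced by R. *)
Notation II R := (set_type (unit_itv R)).

Lemma mem_unit_itv0 (R : realType) : (0 : R) \in unit_itv R.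
Proof. by rewrite inE /unit_itv /= in_itv /= lexx ler01. Qed.

Lemma mem_unit_itv1 (R : realType) : (1 : R) \in unit_itv R.
Proof. by rewrite inE /unit_itv /= in_itv /= lexx ler01. Qed.

Definition II0 (R : realType) : II R := exist _ 0 (mem_unit_itv0 R).
Definition II1 (R : realType) : II R := exist _ 1 (mem_unit_itv1 R).

Section Glob.
Variables (R : realType) (X : topologicalType).

Definition glob_rel (p q : X * II R) : bool :=
  [|| p == q, (p.2 == II0 R) && (q.2 == II0 R)
    | (p.2 == II1 R) && (q.2 == II1 R)].

Lemma glob_rel_refl : reflexive glob_rel.
Proof. by move=> p; rewrite /glob_rel eqxx. Qed.

Lemma glob_rel_sym : symmetric glob_rel.
Proof.
by move=> p q; rewrite /glob_rel eq_sym [(p.2 == II0 R) && _]andbC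
  [(p.2 == II1 R) && _]andbC.
Qed.

Lemma II0_neq1 : (II0 R == II1 R) = false.
Proof. by apply/eqP => /(congr1 val)/eqP /=; rewrite eq_sym oner_eq0. Qed.

Lemma glob_rel_trans : transitive glob_rel.
Proof.
move=> q p r /or3P[/eqP-> //|/andP[/eqP p0 /eqP q0]|/andP[/eqP p1 /eqP q1]].
- move=> /or3P[/eqP<-|/andP[_ r0]|/andP[]].
  + by rewrite /glob_rel p0 q0 !eqxx orbT.
  + by rewrite /glob_rel p0 r0 !eqxx orbT.
  + by rewrite q0 II0_neq1.
- move=> /or3P[/eqP<-|/andP[]|/andP[_ r1]].
  + by rewrite /glob_rel p1 q1 !eqxx !orbT.
  + by rewrite q1 eq_sym II0_neq1.
  + by rewrite /glob_rel p1 r1 !eqxx !orbT.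
Qed.

Definition glob_equiv : equiv_rel (X * II R)%type :=
  EquivRel glob_rel glob_rel_refl glob_rel_sym glob_rel_trans.

Definition Glob := {eq_quot glob_equiv}.

HB.instance Definition _ := Topological.copy Glob (quotient_topology Glob).
HB.instance Definition _ := Quotient.on Glob.

Definition glob_pi : X * II R -> Glob := \pi_Glob.

(* The bottom (resp. top) point as a set of points: it is a singleton when X
   is nonempty, whereas the quotient Glob is empty when X is. *)
Definition glob_bot : set Glob := [set glob_pi (x, II0 R) | x in setT].
Definition glob_top : set Glob := [set glob_pi (x, II1 R) | x in setT].

Definition glob_le (p q : Glob) : Prop :=
  exists (x : X) (t t' : II R),
    [/\ val t <= val t', p = glob_pi (x, t) & q = glob_pi (x, t')].

Definition exec_path (gamma : II R -> Glob) : Prop :=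
  [/\ continuous gamma,
      forall s s' : II R, val s <= val s' -> glob_le (gamma s) (gamma s'),
      glob_bot (gamma (II0 R))
    & glob_top (gamma (II1 R))].

End Glob.
Arguments glob_bot {R X}.
Arguments glob_top {R X}.

Definition glob_map (R : realType) (X Y : topologicalType) (g : X -> Y)
    (p : Glob R X) : Glob R Y :=
  let xt : X * II R := repr p in glob_pi (g xt.1, xt.2).

Lemma glob_mapE (R : realType) (X Y : topologicalType) (g : X -> Y)
    (x : X) (t : II R) :
  glob_map g (glob_pi (x, t)) = glob_pi (g x, t).
Proof.
rewrite /glob_map /glob_pi; apply/eqmodP => /=.
case: piP => -[y s] /eqmodP /= /or3P[/eqP[<- <-]||] /=.
- exact: glob_rel_refl.
- by move=> /andP[/= t0 s0]; rewrite /glob_rel /= t0 s0 orbT.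
- by move=> /andP[/= t1 s1]; rewrite /glob_rel /= t1 s1 !orbT.
Qed.

Definition glob_morphism (R : realType) (X Y : topologicalType)
    (f : Glob R X -> Glob R Y) : Prop :=
  [/\ continuous f,
      f @` (glob_bot `|` glob_top) `<=` glob_bot `|` glob_top
    & forall gamma : II R -> Glob R X,
        exec_path gamma -> exec_path (f \o gamma)].

Definition S_homotopic (R : realType) (X Y : topologicalType)
    (f g : Glob R X -> Glob R Y) : Prop :=
  exists H : Glob R X * II R -> Glob R Y,
    [/\ continuous H,
        forall p, H (p, II0 R) = f p,
        forall p, H (p, II1 R) = g p
      & forall u : II R, glob_morphism (fun p => H (p, u))].

Definition homotopic (R : realType) (X Y : topologicalType)
    (f g : X -> Y) : Prop :=
  exists H : X * II R -> Y,
    [/\ continuous H,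
        forall x, H (x, II0 R) = f x
      & forall x, H (x, II1 R) = g x].
Arguments homotopic R {X Y} f g.

(* Main.v *)
(* Away from the two poles, Glob(Y) is the product of Y with ]0, 1[, and an
   execution path crosses that region inside a single strand {y} x ]0, 1[.
   A morphism f thus reads f(x, t) = (fS x, phi x t), and fS is continuous since
   near each x it is the strand of f(-, t0) for some fixed t0 sending x to an
   inner point. Interpolating linearly between phi x t and t gives the
   S-homotopy from f to Glob(fS). For uniqueness, the strand map of an
   S-homotopy, as a function of (x, u), is continuous for the same reason, hence
   is a homotopy. *)
Require Import Defs.
From mathcomp Require Import all_boot all_order all_algebra generic_quotient.
From mathcomp Require Import all_classical all_reals all_analysis.
From mathcomp Require Import lra.
Set Implicit Arguments.
Unset Strict Implicit.
Unset Printing Implicit Defensive.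
Import Order.TTheory GRing.Theory Num.Theory.
Import numFieldNormedType.Exports.
Local Open Scope classical_set_scope.
Local Open Scope ring_scope.
Local Open Scope quotient_scope.

Lemma continuous_pair (A B C : topologicalType) (f : A -> B) (g : A -> C)
    (a : A) : {for a, continuous f} -> {for a, continuous g} ->
  {for a, continuous (fun x => (f x, g x))}.
Proof. by move=> cf cg; have := cvg_pair cf cg; apply. Qed.

(** * The unit interval as a retract of the real line *)

Section clamp.
Variable R : realType.

Lemma clamp_subproof (r : R) : Num.max 0 (Num.min r 1) \in unit_itv R.
Proof.
by rewrite inE /unit_itv /= in_itv /= le_max lexx ge_max ler01 ge_min lexx orbT.
Qed.

(** Retraction of the line onto the interval. It transfers compactness of segments and the
    intermediate value theorem to [II R], and turns real formulas into points of [II R]. *)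
Definition clamp (r : R) : II R :=
  exist _ (Num.max 0 (Num.min r 1)) (clamp_subproof r).

Lemma II_ge0 (t : II R) : 0 <= val t.
Proof. by have := set_valP t; rewrite /unit_itv /= in_itv /= => /andP[]. Qed.

Lemma II_le1 (t : II R) : val t <= 1.
Proof. by have := set_valP t; rewrite /unit_itv /= in_itv /= => /andP[]. Qed.

Lemma val_clamp (r : R) : 0 <= r <= 1 -> val (clamp r) = r.
Proof. by move=> /andP[r0 r1] /=; rewrite min_l// max_r. Qed.

Lemma clampK (t : II R) : clamp (val t) = t.
Proof. by apply/val_inj; rewrite val_clamp// II_ge0 II_le1. Qed.

Lemma val_II_continuous : continuous (val : II R -> R).
Proof. exact: initial_continuous. Qed.

(** Truncation is 1-Lipschitz. *)
Lemma clamp_continuous : continuous clamp.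
Proof.
apply: continuous_comp_initial => r.
apply/cvgrPdist_lt => e e0; near=> s.
have : `|r - s| < e by near: s; apply: cvgr_dist_lt.
apply: le_lt_trans; rewrite /= set_valE /=.
have := ler_norm (r - s); have := ler_norm (s - r).
rewrite (distrC s r) ler_norml.
case: (leP r 1); case: (leP s 1); case: (leP 0 r); case: (leP 0 s);
  rewrite ?(max_r ler01) => *; apply/andP; split; lra.
Unshelve. all: by end_near. Qed.

(** Local compactness of the interval, in the form that [quotient_prod_continuous] asks of its
    second factor. *)
Lemma nbhs_II_compact (u : II R) (U : set (II R)) : nbhs u U ->
  exists K, [/\ compact K, nbhs u K & K `<=` U].
Proof.
move=> uU.
have : nbhs (val u) (clamp @^-1` U) by apply: clamp_continuous; rewrite clampK.
rewrite -nbhs_ballE => -[e /= e0 eU].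
(* Halving the radius keeps the closed segment inside the open ball of radius [e]. *)
exists (clamp @` `[val u - e / 2, val u + e / 2]); split.
- apply: continuous_compact; last exact: segment_compact.
  exact/continuous_subspaceT/clamp_continuous.
- have : nbhs u (val @^-1` ball (val u) (e / 2)).
    by apply: val_II_continuous; apply: nbhsx_ballx; rewrite divr_gt0.
  apply: filterS => v /= uv.
  exists (val v); last exact: clampK.
  by move: uv; rewrite /ball /= in_itv /= ltr_norml => /andP[? ?]; lra.
- move=> _ [r /= + <-]; rewrite in_itv /= => /andP[? ?]; apply: eU.
  by rewrite /ball /= ltr_norml; lra.
Qed.

End clamp.
Arguments clamp {R} r.

(* Quotient maps are stable under products with locally compact spaces: the
   tube lemma makes the set of points whose slice over a compact neighbourhood
   lies in a given open set saturated open. *)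
Lemma quotient_prod_continuous (T V Z : topologicalType) (Q : quotType T)
    (H : quotient_topology Q * V -> Z) :
  (forall (v : V) (U : set V), nbhs v U ->
    exists K, [/\ compact K, nbhs v K & K `<=` U]) ->
  continuous (fun p : T * V => H (\pi_(quotient_topology Q) p.1, p.2)) ->
  continuous H.
Proof.
move=> lcV cH [q v] U; rewrite nbhsE /= => -[W0 [oW0 W0H] W0U].
pose Hpi := fun p : T * V => H (\pi_(quotient_topology Q) p.1, p.2).
have oHpi : open (Hpi @^-1` W0) by move/continuousP: cH; apply.
have [K [cK vK KW0]] : exists K,
    [/\ compact K, nbhs v K & K `<=` (fun w => H (q, w)) @^-1` W0].
  apply: lcV.
  have : nbhs (repr q, v) (Hpi @^-1` W0).
    by apply: open_nbhs_nbhs; split => //; rewrite /Hpi /= reprK.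
  move=> [[A B] /= [/nbhs_singleton Aq Bv] ABW].
  apply: filterS Bv => w Bw; have := ABW (repr q, w) (conj Aq Bw).
  by rewrite /Hpi /= reprK.
pose W : set (quotient_topology Q) := [set p | forall w, K w -> W0 (H (p, w))].
have oW : open W.
  rewrite /open /= /quotient_open openE => x /= Wx.
  (* Near-covering form of compactness: neighbourhoods of [x] found separately for each [w] in [K]
     yield one that serves all of [K]. *)
  have := (compact_near_coveringP K).1 cK T (nbhs x)
    (fun x w => W0 (Hpi (x, w))) _.
  apply => w Kw.
  have : nbhs (x, w) (Hpi @^-1` W0).
    by apply: open_nbhs_nbhs; split => //; exact: Wx.
  move=> [[A B] /= [Ax Bw] ABW]; exists (B, A) => //= -[w' x'] /= [Bw' Ax'].
  exact: (ABW (x', w')).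
exists (W, K) => /=.
  by split => //; apply: open_nbhs_nbhs; split.
by move=> [p w] /= [Wp Kw]; apply: W0U; exact: Wp.
Qed.

(** * Coordinates on the globe and execution paths *)

Section height_strand.
Variables (R : realType) (X : topologicalType).
Implicit Types (p : Glob R X) (x : X) (t : II R).

(** Independent of the representative, even at the poles: the identifications never change the
    second coordinate. *)
Definition height p : II R := (repr p : X * II R).2.

(* Arbitrary, depending on the choice of a representative, at the two poles. *)
Definition strand p : X := (repr p : X * II R).1.

Lemma globE p : p = glob_pi (strand p, height p).
Proof. by rewrite /glob_pi -surjective_pairing reprK. Qed.

Lemma glob_pi_bot x x' : glob_pi (x, Defs.II0 R) = glob_pi (x', Defs.II0 R).
Proof. by apply/eqmodP; rewrite /= /glob_rel /= eqxx orbT. Qed.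

Lemma glob_pi_top x x' : glob_pi (x, Defs.II1 R) = glob_pi (x', Defs.II1 R).
Proof. by apply/eqmodP; rewrite /= /glob_rel /= eqxx !orbT. Qed.

Lemma height_pi x t : height (glob_pi (x, t)) = t.
Proof.
have /eqmodP /= := globE (glob_pi (x, t)).
by rewrite /glob_rel => /or3P[/eqP[_ <-]||] //= /andP[/eqP-> /eqP->].
Qed.

Lemma strand_pi x t : 0 < val t < 1 -> strand (glob_pi (x, t)) = x.
Proof.
move=> /andP[t0 t1]; have /eqmodP /= := globE (glob_pi (x, t)).
rewrite /glob_rel => /or3P[/eqP[<-]||] //= /andP[/eqP tE _].
- by rewrite tE /= ltxx in t0.
- by rewrite tE /= ltxx in t1.
Qed.

Lemma glob_pi_continuous : continuous (@glob_pi R X).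
Proof. exact: pi_continuous. Qed.

Lemma height_continuous : continuous height.
Proof.
apply: (@repr_comp_continuous _ (Glob R X) _ (fun q : X * II R => q.2)).
  by move=> q; exact: cvg_snd.
move=> [x t] [y s] /eqP xy; apply/eqP; rewrite /= -(height_pi x t).
by rewrite (xy : glob_pi (x, t) = glob_pi (y, s)) height_pi.
Qed.

Lemma val_height_continuous : continuous (fun p => val (height p) : R).
Proof.
move=> p; apply: (@continuous_comp _ _ _ height val).
  exact: height_continuous.
exact: val_II_continuous.
Qed.

Lemma strand_continuous p : 0 < val (height p) < 1 ->
  strand q @[q --> p] --> strand p.
Proof.
move=> hp U; rewrite nbhsE => -[V [oV Vp] VU].
pose I01 := [set t : II R | 0 < val t < 1].
have oI01 : open I01.
  rewrite (_ : I01 = val @^-1` [set` `]0, 1[]); last first.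
    by apply/seteqP; split=> t; rewrite /I01 /= in_itv.
  by move/continuousP: (@val_II_continuous R); apply; exact: itv_open.
(* Away from the poles classes are singletons, so [W] pulls back to the open product of [V] and
   [I01]. *)
pose W : set (Glob R X) := [set q | V (strand q) /\ I01 (height q)].
have oW : open W.
  rewrite /open /= /quotient_open
    (_ : _ @^-1` _ = fst @^-1` V `&` snd @^-1` I01); last first.
    apply/seteqP; split=> -[x t]; rewrite /W /= -/(glob_pi (x, t)) height_pi.
      by move=> [+ ht]; rewrite strand_pi.
    by move=> [Vx ht]; rewrite strand_pi.
  apply: openI; [apply: open_comp => // q _; exact: cvg_fst|].
  by apply: open_comp => // q _; exact: cvg_snd.
have : nbhs p W by apply: open_nbhs_nbhs; split.
by apply: filterS => q [Vq _]; exact: VU.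
Qed.

Lemma glob_le_height p q : glob_le p q -> val (height p) <= val (height q).
Proof. by move=> [x [t [t' [tt' -> ->]]]]; rewrite !height_pi. Qed.

Lemma glob_bot_height p : glob_bot p -> height p = Defs.II0 R.
Proof. by move=> [x _ <-]; rewrite height_pi. Qed.

Lemma glob_top_height p : glob_top p -> height p = Defs.II1 R.
Proof. by move=> [x _ <-]; rewrite height_pi. Qed.

(** The height along the path is continuous and runs from 0 to 1, hence takes the value 1/2. *)
Lemma exec_path_inner (gamma : II R -> Glob R X) : exec_path gamma ->
  exists t, 0 < val (height (gamma t)) < 1.
Proof.
move=> [cg _ /glob_bot_height g0 /glob_top_height g1].
pose h (r : R) : R := val (height (gamma (clamp r))).
have ch : continuous h.
  move=> r; apply: (@continuous_comp _ _ _ (gamma \o clamp) (val \o height)).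
    by apply: continuous_comp; [exact: clamp_continuous|exact: cg].
  exact: val_height_continuous.
have h0 : h 0 = 0 by rewrite /h -[0]/(val (Defs.II0 R)) clampK g0.
have h1 : h 1 = 1 by rewrite /h -[1]/(val (Defs.II1 R)) clampK g1.
have [] := @IVT _ h 0 1 2^-1 ler01 (continuous_subspaceT ch).
  by rewrite h0 h1 min_l// max_r//; lra.
by move=> c _ hc; exists (clamp c); rewrite -/(h c) hc; lra.
Qed.

(** By monotonicity [gamma t] and [gamma t0] are comparable, so they lie on a common strand; as
    [gamma t0] is an inner point, that strand is its own. *)
Lemma exec_path_strand (gamma : II R -> Glob R X) (t0 t : II R) :
  exec_path gamma -> 0 < val (height (gamma t0)) < 1 ->
  gamma t = glob_pi (strand (gamma t0), height (gamma t)).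
Proof.
move=> [_ mono _ _] h0.
have [le|/ltW le] := leP (val t) (val t0).
  have [x [s [s' [_ -> Es']]]] := mono _ _ le.
  by move: h0; rewrite Es' !height_pi => h0; rewrite strand_pi.
have [x [s [s' [_ Es ->]]]] := mono _ _ le.
by move: h0; rewrite Es !height_pi => h0; rewrite strand_pi.
Qed.

(** These vertical paths serve as probes: a morphism sends each of them to an execution path, hence
    into a single strand. *)
Lemma exec_path_pi x : exec_path (fun t => glob_pi (x, t)).
Proof.
split=> [t|s s' ss'||]; last 2 first.
- by exists x.
- by exists x.
- apply: continuous_comp; last exact: glob_pi_continuous.
  by apply: continuous_pair; [exact: cst_continuous|exact: cvg_id].
- by exists x, s, s'.
Qed.

End height_strand.
Arguments height {R X} p.
Arguments strand {R X} p.

(** * Strands of execution paths depending on a parameter *)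

Section exec_path_family.
Variables (R : realType) (Y Z : topologicalType) (F : Z -> II R -> Glob R Y).
Hypothesis execF : forall z, exec_path (F z).

(** The parameter space [Z] is [X] in the construction of [fS], and [X * II R] when an S-homotopy is
    turned into a homotopy. *)
Lemma exec_path_family_strand :
  exists y : Z -> Y, forall z t, F z t = glob_pi (y z, height (F z t)).
Proof.
have /choice[y yP] : forall z, exists y : Y,
    forall t, F z t = glob_pi (y, height (F z t)).
  move=> z; have [t0 h0] := exec_path_inner (execF z).
  by exists (strand (F z t0)) => t; exact: exec_path_strand.
by exists y.
Qed.

(** Being an inner point is an open condition, so the [t0] chosen at [z] still serves for nearby
    parameters, where [y] coincides with the strand of [F ^~ t0]. *)
Lemma exec_path_family_continuous (y : Z -> Y) :
  (forall t, continuous (F ^~ t)) ->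
  (forall z t, F z t = glob_pi (y z, height (F z t))) -> continuous y.
Proof.
move=> cF yE z; have [t0 h0] := exec_path_inner (execF z).
have sE z' : 0 < val (height (F z' t0)) < 1 -> strand (F z' t0) = y z'.
  by move=> h; rewrite yE strand_pi.
suff : y x @[x --> z] --> strand (F z t0) by rewrite sE.
apply: cvg_trans (cvg_comp _ _ (cF t0 z) (strand_continuous h0)).
apply: near_eq_cvg; near=> z'; apply: sE.
near: z'.
have ch : continuous (fun z' => val (height (F z' t0))).
  move=> w; apply: (@continuous_comp _ _ _ (F ^~ t0) (val \o height)).
    exact: cF.
  exact: val_height_continuous.
move/andP: h0 => [h0 h1].
apply: filterS2 (cvgr_gt _ (ch z) _ h0) (cvgr_lt _ (ch z) _ h1) => w ? ?.
exact/andP.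
Unshelve. all: by end_near. Qed.

End exec_path_family.

(** * Morphisms and S-homotopies read strand by strand *)

Lemma glob_morphism_strandwise (R : realType) (X Y : topologicalType)
    (G : Glob R X -> Glob R Y) (g : X -> Y) (phi : X -> II R -> II R) :
  continuous G ->
  (forall x t, G (glob_pi (x, t)) = glob_pi (g x, phi x t)) ->
  (forall x, phi x (Defs.II0 R) = Defs.II0 R) ->
  (forall x, phi x (Defs.II1 R) = Defs.II1 R) ->
  (forall x t t', val t <= val t' -> val (phi x t) <= val (phi x t')) ->
  glob_morphism G.
Proof.
move=> cG GE phi0 phi1 phi_mono; split=> //.
- move=> _ [p + <-] => -[[x _ <-]|[x _ <-]]; rewrite GE ?phi0 ?phi1.
    by left; exists (g x).
  by right; exists (g x).
- move=> gamma [cg mono [x0 _ g0] [x1 _ g1]]; split.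
  + by move=> t; apply: continuous_comp; [exact: cg|exact: cG].
  + move=> s s' /mono[x [t [t' [tt' /= -> ->]]]].
    exists (g x), (phi x t), (phi x t'); split; rewrite ?GE//.
    exact: phi_mono.
  + by exists (g x0) => //=; rewrite -g0 GE phi0.
  + by exists (g x1) => //=; rewrite -g1 GE phi1.
Qed.

Lemma glob_morphism_exec_path (R : realType) (X Y : topologicalType)
    (f : Glob R X -> Glob R Y) (x : X) :
  glob_morphism f -> exec_path (fun t => f (glob_pi (x, t))).
Proof. by case=> _ _ /(_ _ (exec_path_pi R x)). Qed.

(** On each strand, the height of [f] and the original height are both nondecreasing from 0 to 1;
    convex combinations inherit this, so every stage of the interpolation is a morphism. *)
Lemma S_homotopic_glob_map (R : realType) (X Y : topologicalType)
    (f : Glob R X -> Glob R Y) (g : X -> Y) :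
  glob_morphism f -> continuous g ->
  (forall x t,
    f (glob_pi (x, t)) = glob_pi (g x, height (f (glob_pi (x, t))))) ->
  S_homotopic f (glob_map g).
Proof.
move=> fM cg gE; have [cf _ _] := fM.
pose h p := val (height (f p)).
pose k (p : Glob R X) (u : II R) :=
  (1 - val u) * h p + val u * val (height p).
pose H (pu : Glob R X * II R) := glob_pi (g (strand pu.1), clamp (k pu.1 pu.2)).
have path x := glob_morphism_exec_path x fM.
have h0 x : h (glob_pi (x, Defs.II0 R)) = 0.
  by have [_ _ /glob_bot_height b _] := path x; rewrite /h b.
have h1 x : h (glob_pi (x, Defs.II1 R)) = 1.
  by have [_ _ _ /glob_top_height b] := path x; rewrite /h b.
have k0 x u : clamp (k (glob_pi (x, Defs.II0 R)) u) = Defs.II0 R.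
  rewrite -[RHS]clampK; congr clamp.
  by rewrite /k h0 height_pi /= !mulr0 addr0.
have k1 x u : clamp (k (glob_pi (x, Defs.II1 R)) u) = Defs.II1 R.
  rewrite -[RHS]clampK; congr clamp.
  by rewrite /k h1 height_pi /= !mulr1 subrK.
have kE p u : val (clamp (k p u)) = k p u.
  apply: val_clamp; rewrite /k.
  have := II_ge0 u; have := II_le1 u.
  have := II_ge0 (height p); have := II_le1 (height p).
  have := II_ge0 (height (f p)); have := II_le1 (height (f p)).
  rewrite /h; nra.
(* At a pole [strand] may return a point other than [x], but the interpolated height is then 0 or 1,
   where all strands meet. *)
have HE x t u :
    H (glob_pi (x, t), u) = glob_pi (g x, clamp (k (glob_pi (x, t)) u)).
  rewrite /H /=.
  have [->|t0] := eqVneq t (Defs.II0 R).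
    by rewrite k0; exact: glob_pi_bot.
  have [->|t1] := eqVneq t (Defs.II1 R).
    by rewrite k1; exact: glob_pi_top.
  rewrite strand_pi// !lt_neqAle II_ge0 II_le1 !andbT.
  by apply/andP; split; [rewrite eq_sym|]; [apply: contra t0|apply: contra t1];
    move=> /eqP ?; apply/eqP/val_inj.
(* Since [strand] can fail to be continuous at the poles, continuity is checked before passing to
   the quotient, where [HE] replaces [strand] by a projection. *)
have cH : continuous H.
  apply: (@quotient_prod_continuous _ _ _ (Glob R X)).
    exact: nbhs_II_compact.
  rewrite (_ : (fun _ => _) = (fun xtu : (X * II R) * II R =>
      glob_pi (g xtu.1.1, clamp (k (glob_pi xtu.1) xtu.2)))); last first.
    by apply/funext => -[[x t] u]; exact: HE.
  move=> xtu; apply: continuous_comp; last exact: glob_pi_continuous.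
  have c1 : continuous (fun xtu : (X * II R) * II R => xtu.1).
    by move=> ?; exact: cvg_fst.
  have c2 : continuous (fun xtu : (X * II R) * II R => val xtu.2).
    move=> w; apply: (@continuous_comp _ _ _ (@snd (X * II R) (II R)) val).
      exact: cvg_snd.
    exact: val_II_continuous.
  have cpi : continuous (fun xtu : (X * II R) * II R => glob_pi xtu.1).
    by move=> w; apply: continuous_comp; [exact: c1|exact: glob_pi_continuous].
  have ch : continuous h.
    move=> p; apply: (@continuous_comp _ _ _ f (val \o height)).
      exact: cf.
    exact: val_height_continuous.
  apply: continuous_pair.
    apply: continuous_comp; last exact: cg.
    by apply: continuous_comp; [exact: c1|exact: cvg_fst].
  apply: continuous_comp; last exact: clamp_continuous.
  apply: cvgD; apply: cvgM.
  - by apply: cvgB; [exact: cst_continuous|exact: c2].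
  - apply: (@continuous_comp _ _ _ (@glob_pi R X \o fst) h); first exact: cpi.
    exact: ch.
  - exact: c2.
  - apply: (@continuous_comp _ _ _ (@glob_pi R X \o fst) (val \o height)).
      exact: cpi.
    exact: val_height_continuous.
exists H; split => //.
- move=> p; rewrite [p]globE HE gE; congr (glob_pi (_, _)).
  by rewrite /k /= subr0 mul1r mul0r addr0 /h clampK.
- move=> p; rewrite [p]globE HE glob_mapE; congr (glob_pi (_, _)).
  by rewrite /k /= subrr mul0r mul1r add0r height_pi clampK.
- move=> u; apply: (@glob_morphism_strandwise _ _ _ _ g
      (fun x t => clamp (k (glob_pi (x, t)) u))) => //.
  + move=> p.
    apply: (@continuous_comp _ _ _ (fun p => (p, u)) H); last exact: cH.
    by apply: continuous_pair; [exact: cvg_id|exact: cst_continuous].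
  + move=> x t t' tt'; rewrite !kE /k !height_pi.
    have [_ mono _ _] := path x.
    have := glob_le_height (mono _ _ tt'); rewrite -!/(h _) => hh.
    by rewrite lerD// ler_wpM2l ?II_ge0// subr_ge0 II_le1.
Qed.

(** The vertical paths at all stages of the S-homotopy form a family of execution paths indexed by
    [(x, u)], and its strand map is the homotopy. *)
Lemma homotopic_of_S_homotopic (R : realType) (X Y : topologicalType)
    (f f' : Glob R X -> Glob R Y) (g g' : X -> Y) :
  (forall x t,
    f (glob_pi (x, t)) = glob_pi (g x, height (f (glob_pi (x, t))))) ->
  (forall x t,
    f' (glob_pi (x, t)) = glob_pi (g' x, height (f' (glob_pi (x, t))))) ->
  S_homotopic f f' -> homotopic R g g'.
Proof.
move=> gE g'E [H [cH H0 H1 HM]].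
pose F (z : X * II R) t := H (glob_pi (z.1, t), z.2).
have execF z : exec_path (F z) := glob_morphism_exec_path z.1 (HM z.2).
have [y yE] := exec_path_family_strand execF.
(* An inner point of the path determines its strand; this identifies [y] with [g] and [g'] at the
   two ends. *)
have uniq z (y1 : Y) :
    (forall t, F z t = glob_pi (y1, height (F z t))) -> y z = y1.
  move=> y1E; have [t0 h0] := exec_path_inner (execF z).
  by rewrite -(strand_pi (y z) h0) -yE {1}y1E strand_pi.
have cF t : continuous (F ^~ t).
  move=> z; apply: continuous_comp; last exact: cH.
  apply: continuous_pair; last exact: cvg_snd.
  apply: continuous_comp; last exact: glob_pi_continuous.
  by apply: continuous_pair; [exact: cvg_fst|exact: cst_continuous].
have cy := exec_path_family_continuous execF cF yE.
exists y; split.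
- exact: cy.
- by move=> x; apply: uniq => t; rewrite /F H0.
- by move=> x; apply: uniq => t; rewrite /F H1.
Qed.

Theorem theorem5p7 (R : realType) (X Y : topologicalType)
  (cgX : compactly_generated X) (cgY : compactly_generated Y)
  (f : Glob R X -> Glob R Y) (fM : glob_morphism f) :
  exists fS : X -> Y,
    [/\ continuous fS,
        S_homotopic f (glob_map fS)
      & forall g : X -> Y, continuous g -> S_homotopic f (glob_map g) ->
          homotopic R fS g].
Proof.
have execF x : exec_path (fun t => f (glob_pi (x, t))).
  exact: glob_morphism_exec_path.
have [fS fSE] := exec_path_family_strand execF.
have [cf _ _] := fM.
have cF t : continuous (fun x => f (glob_pi (x, t))).
  move=> x; apply: continuous_comp; last exact: cf.
  apply: continuous_comp; last exact: glob_pi_continuous.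
  by apply: continuous_pair; [exact: cvg_id|exact: cst_continuous].
have cfS := exec_path_family_continuous execF cF fSE.
exists fS; split => //; first exact: S_homotopic_glob_map.
(* The strand map of [glob_map g] is [g] itself, since heights are preserved. *)
move=> g _; apply: homotopic_of_S_homotopic => // x t.
by rewrite glob_mapE height_pi.
Qed.
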